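(* Let $f\in H$ be not identically $0$, and for each integer $n\ge 0$ let $p_n^*$ be the optimal approximant of degree $n$ of $1/f$. (a) If $h$ is the orthogonal projection of the constant function $1$ onto $[f]$, then $h$ is the unique function such that $\|p_n^*f-h\|\to0$ as $n\to\infty$. (b) If $f$ is $H$-inner, then all the optimal approximants are constants: $p_n^*(z)=\overline{f(0)}$ for every $n \ge 0$. (c) If $f$ is $H$-inner, then for every $n\ge 0$, $\|p_n^*f-1\|^2=\mathrm{dist}_H^2(1,[f])=1-|f(0)|^2$.
   Context: Let $\omega=(\omega_k)_{k\ge 0}$ be a sequence of positive real numbers with $\omega_0=1$ and $\lim_{k\to\infty}\omega_k/\omega_{k+1}=1$. Let $\mathbb{D}$ be the open unit disk in $\mathbb{C}$. $H=H^2_\omega$ is the Hilbert space of holomorphic functions $f(z)=\sum_{k\ge0}a_kz^k$ on $\mathbb{D}$ with $\|f\|^2:=\sum_{k\ge0}|a_k|^2\omega_k<\infty$, with inner product $\langle\sum a_kz^k,\sum b_kz^k\rangle=\sum_k a_k\overline{b_k}\,\omega_k$. Multiplication by $z$ is a bounded operator on $H$. For $f\in H$, $[f]$ denotes the closure in $H$ of $\{pf: p \text{ a polynomial}\}$. $\mathrm{dist}_H(1,[f])$ is the distance in the norm of $H$ from the constant function $1$ to $[f]$. A function $f\in H$ is called $H$-inner if $\|f\|=1$ and $\langle z^jf,f\rangle=0$ for all integers $j>0$. Let $\mathcal{P}_n$ be the space of polynomials of degree at most $n$. For $f\in H$ not identically $0$, the optimal approximant of degree $n$ of $1/f$ is the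 unique polynomial $p_n^*\in\mathcal{P}_n$ minimizing $\|pf-1\|$ among all $p\in\mathcal{P}_n$; equivalently, $p_n^*f$ is the orthogonal projection of $1$ onto $\mathcal{P}_nf$. *)

(* Defs.v *)
From mathcomp Require Import all_boot all_order all_algebra.
From mathcomp Require Import all_classical all_reals all_analysis.
From mathcomp Require Import complex.

Set Implicit Arguments.
Unset Strict Implicit.
Unset Printing Implicit Defensive.

Import Order.TTheory GRing.Theory Num.Theory.
Import numFieldNormedType.Exports.

Local Open Scope classical_set_scope.
Local Open Scope ring_scope.
Local Open Scope complex_scope.

(* The order on [R[i]] is partial; [`|z| < 1] is nevertheless the usual
   condition because [`|z|] is the modulus, viewed as an element of [R[i]]. *)
Definition disk (R : realType) := {z : R[i] | `|z| < 1}.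

Lemma disk0_subproof (R : realType) : `|0 : R[i]| < 1.
Proof. by rewrite normr0 ltr01. Qed.

Definition disk0 (R : realType) : disk R :=
  exist (fun z : R[i] => `|z| < 1) 0 (disk0_subproof R).

(* The real-valued modulus. *)
Notation cmod := ComplexField.Normc.normc.

Section WeightedHardySpace.
Variable R : realType.
Local Notation C := R[i].

(* [C^o] carries the topology of the modulus. *)
Definition power_series_of (f : disk R -> C) (a : nat -> C) : Prop :=
  forall z : disk R,
    series (fun k => (a k * val z ^+ k : C^o)) @ \oo --> (f z : C^o).

(* The coefficients are unique when they exist; the value is [0] otherwise. *)
Definition coefs (f : disk R -> C) : nat -> C :=
  xget (fun=> 0) [set a | power_series_of f a].

Variable w : nat -> R.

Definition H2 : set (disk R -> C) := [set f |
  power_series_of f (coefs f) /\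
  cvgn (series (fun k => cmod (coefs f k) ^+ 2 * w k))].

Definition hnorm (f : disk R -> C) : R :=
  Num.sqrt (limn (series (fun k => cmod (coefs f k) ^+ 2 * w k))).

Definition hinner (f g : disk R -> C) : C :=
  limn (series (fun k => (coefs f k * (coefs g k)^* * (w k)%:C : C^o))).

Definition pmul (p : {poly C}) (f : disk R -> C) : disk R -> C :=
  fun z => p.[val z] * f z.

Definition hone : disk R -> C := fun=> 1.

Definition cyclic_span (f : disk R -> C) : set (disk R -> C) := [set g |
  H2 g /\ forall e : R, 0 < e -> exists p : {poly C}, hnorm (pmul p f \- g) < e].

Definition hdist (u : disk R -> C) (M : set (disk R -> C)) : R :=
  inf [set hnorm (u \- g) | g in M].

Definition is_orthogonal_projection (M : set (disk R -> C))
    (u v : disk R -> C) : Prop :=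
  M v /\ forall g, M g -> hinner (u \- v) g = 0.

Definition H_inner (f : disk R -> C) : Prop :=
  [/\ H2 f, hnorm f = 1 &
      forall j : nat, (0 < j)%N -> hinner (pmul 'X^j f) f = 0].

(* [size p <= n.+1] says that [p] has degree at most [n]. *)
Definition is_optimal_approximant (f : disk R -> C) (n : nat) (p : {poly C}) :
    Prop :=
  (size p <= n.+1)%N /\
  forall q : {poly C}, (size q <= n.+1)%N ->
    hnorm (pmul p f \- hone) <= hnorm (pmul q f \- hone).

End WeightedHardySpace.

Arguments hone {R}.

(* Main.v *)
Require Import Defs.
From mathcomp Require Import all_boot all_order all_algebra.
From mathcomp Require Import all_classical all_reals all_analysis.
From mathcomp Require Import complex.
From mathcomp Require Import ring lra.
Import Order.TTheory GRing.Theory Num.Theory.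
Import numFieldNormedType.Exports.
Local Open Scope classical_set_scope.
Local Open Scope ring_scope.
Local Open Scope complex_scope.

(** The theorem is Hilbert space geometry, once the weighted space of power
    series is known to be an inner product space stable under multiplication
    by polynomials.

    Suppose [h] is such that [hone \- h] is orthogonal to [h] and to all
    polynomial multiples [q f].  By Pythagoras
      [N (q f \- hone) ^+ 2 = N (q f \- h) ^+ 2 + N (hone \- h) ^+ 2],
    so minimizing the distance of [q f] to the constant [1] is the same as
    minimizing its distance to [h] ([norm_projection_mono]).

    - (a) The projection [h] of [1] onto the cyclic span is a limit of
      polynomial multiples [q f]; as soon as [n] is at least the size of [q],
      the optimal approximant [p n] does at least as well as [q], so
      [p n * f] tends to [h].  Limits in norm are unique because a function of
      norm [0] has only zero coefficients.

    - (b) If [f] is inner then [h := c f], with [c] the conjugate of the value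
      [f 0], has the orthogonality property: the inner product of [1] with
      [q f] is the conjugate of [q 0 * f 0], and the inner product of [f] with
      [q f] is the conjugate of [q 0] since only the constant term of [q]
      survives ([inner_residual_orthogonal]).  As [h] is itself a polynomial
      multiple of [f] of degree [0], optimality gives [p n * f = c f], and [f]
      can be cancelled by looking at its lowest nonzero coefficient
      ([pmul_eq0]).

    - (c) The same [h] lies in the cyclic span and minimizes the distance to
      [1] among polynomial multiples, hence among their limits
      ([hdist_inner]); expanding the square of the norm gives
      [1 - `|f 0| ^ 2].

    The analytic input is the identity theorem for power series, which makes
    the coefficients of a function well defined ([power_series_unique]), and
    the boundedness of the shift, where the ratio of consecutive weights
    enters ([H2_mulX]). *)

(** * Complex series and the identity theorem for power series *)

Section ComplexSeries.
Context {R : realType}.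
Local Notation C := R[i].
Local Notation Re := complex.Re.
Local Notation Im := complex.Im.
Implicit Types (u v : nat -> C) (a b c l z : C) (s t : nat -> R).

Lemma cmod_ge0 z : 0 <= cmod z.
Proof. by case: z => x y /=; rewrite sqrtr_ge0. Qed.

Lemma normcC z : `|z| = (cmod z)%:C.
Proof. by case: z. Qed.

Lemma cmod_sqr z : cmod z ^+ 2 = Re z ^+ 2 + Im z ^+ 2.
Proof. by case: z => x y /=; rewrite sqr_sqrtr ?addr_ge0 ?sqr_ge0. Qed.

Lemma cmod_real (x : R) : cmod x%:C = `|x|.
Proof. by rewrite /= expr0n addr0 sqrtr_sqr. Qed.

Lemma cmodX z n : cmod (z ^+ n) = cmod z ^+ n.
Proof.
elim: n => [|n IH]; first exact: ComplexField.Normc.normc1.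
by rewrite !exprS ComplexField.Normc.normcM IH.
Qed.

Lemma cmod_conj z : cmod (z^*) = cmod z.
Proof. by case: z => x y /=; rewrite sqrrN. Qed.

Lemma mulcJ z : z * z^* = (cmod z ^+ 2)%:C.
Proof. by rewrite rmorphXn /= -normcC -sqr_normc. Qed.

(** Convergence of complex sequences with real tolerances: it avoids
    quantifying over complex [eps], for which the order is only partial. *)
Lemma cvgcP {u l} :
  (u @ \oo --> (l : C^o)) <->
  (forall e : R, 0 < e -> \forall n \near \oo, cmod (l - u n) < e).
Proof.
split=> [/(@cvgrPdist_lt _ C^o) h e e0|h].
  have := h e%:C; rewrite ltcR => /(_ e0).
  by apply: filterS => n; rewrite normcC ltcR.
apply/(@cvgrPdist_lt _ C^o) => e e0.
have ee : e = (Re e)%:C by rewrite RRe_real // gtr0_real.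
have e0' : 0 < Re e by rewrite -ltcR -ee.
move: (h _ e0'); apply: filterS => n.
by rewrite normcC ee ltcR.
Qed.

Lemma cvg_real {s} {x : R} : s @ \oo --> x ->
  (fun n => (s n)%:C : C^o) @ \oo --> (x%:C : C^o).
Proof.
move=> /cvgrPdist_lt h; apply/cvgcP => e e0.
move: (h e e0); apply: filterS => n.
by rewrite -rmorphB cmod_real.
Qed.

Lemma cvg_conj {u l} : u @ \oo --> (l : C^o) ->
  (fun n => (u n)^* : C^o) @ \oo --> (l^* : C^o).
Proof.
move=> /cvgcP h; apply/cvgcP => e e0.
by move: (h e e0); apply: filterS => n; rewrite -rmorphB cmod_conj.
Qed.

Lemma cvg_lin {u v a b} c :
  u @ \oo --> (a : C^o) -> v @ \oo --> (b : C^o) ->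
  (fun n => c * u n + v n : C^o) @ \oo --> (c * a + b : C^o).
Proof.
move=> /cvgcP ua /cvgcP vb; apply/cvgcP => e e0.
have c0 := cmod_ge0 c.
have d0 : 0 < e / (2 * (cmod c + 1)) by rewrite divr_gt0 //; lra.
have e20 : 0 < e / 2 by lra.
near=> n.
have un : cmod (a - u n) < e / (2 * (cmod c + 1)) by near: n; exact: ua.
have vn : cmod (b - v n) < e / 2 by near: n; exact: vb.
rewrite opprD addrACA -mulrBr.
apply: (le_lt_trans (le_normcD _ _)); rewrite ComplexField.Normc.normcM.
have -> : e = e / 2 + e / 2 by lra.
apply: ler_ltD => //.
have -> : e / 2 = (cmod c + 1) * (e / (2 * (cmod c + 1))).
  by field; rewrite gt_eqF //; lra.
by apply: ler_pM; rewrite ?cmod_ge0 ?(ltW un) //; lra.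
Unshelve. all: by end_near.
Qed.

Lemma cvg_scale {u l} c : u @ \oo --> (l : C^o) ->
  (fun n => c * u n : C^o) @ \oo --> (c * l : C^o).
Proof.
move=> ul.
have c0 : (fun=> 0 : C^o) @ \oo --> (0 : C^o) by exact: cvg_cst.
have := cvg_lin c ul c0.
by rewrite addr0; under eq_fun do rewrite addr0.
Qed.

Lemma cvg_complex {s t} {x y : R} : s @ \oo --> x -> t @ \oo --> y ->
  (fun n => (s n +i* t n) : C^o) @ \oo --> (x +i* y : C^o).
Proof.
move=> sx ty; have -> : x +i* y = 'i%C * y%:C + x%:C :> C by simpc.
under eq_fun => n.
  have -> : s n +i* t n = 'i%C * (t n)%:C + (s n)%:C :> C by simpc.
  over.
exact: cvg_lin (cvg_real ty) (cvg_real sx).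
Qed.

Lemma cvg_series_lin {u v a b} c :
  series (u : nat -> C^o) @ \oo --> (a : C^o) ->
  series (v : nat -> C^o) @ \oo --> (b : C^o) ->
  series (fun k => c * u k + v k : C^o) @ \oo --> (c * a + b : C^o).
Proof.
move=> ua vb.
rewrite (_ : series _ = fun n => c * series u n + series v n).
  exact: (cvg_lin c ua vb).
by apply/funext => n; rewrite /series /= big_split /= mulr_sumr.
Qed.

Definition shift u k : C := if k is k'.+1 then u k' else 0.

Lemma cvg_series_shift {V : normedModType C} (u : nat -> V) (l : V) :
  series u @ \oo --> l ->
  series (fun k => u k.+1) @ \oo --> l - u 0%N.
Proof.
move=> ul.
rewrite (_ : series _ = fun n => series u n.+1 - u 0%N).
  apply: cvgB; last exact: cvg_cst.
  by rewrite (cvg_shiftS (series u)).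
by apply/funext => n; rewrite /series /= big_nat_recl // addrC addKr.
Qed.

Lemma cvg_series_unshift {K : numFieldType} {V : normedModType K}
    (u : nat -> V) (l : V) :
  series (fun k => u k.+1) @ \oo --> l ->
  series u @ \oo --> l + u 0%N.
Proof.
move=> ul; rewrite -(cvg_shiftS (series u)).
rewrite (_ : [sequence _]_n = fun n => series (fun k => u k.+1) n + u 0%N).
  by apply: cvgD => //; exact: cvg_cst.
by apply/funext => n; rewrite /series /= big_nat_recl // addrC.
Qed.

Lemma geometric_half (x : R) n : 0 <= x <= 2^-1 ->
  \sum_(0 <= k < n) x ^+ k <= 2.
Proof.
move=> /andP[x0 x1]; elim: n => [|n IH]; first by rewrite big_geq.
rewrite big_nat_recl // expr0.
under eq_bigr do rewrite exprS.
rewrite -mulr_sumr.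
have : x * \sum_(0 <= i < n) x ^+ i <= 2^-1 * 2.
  by apply: ler_pM => //; apply: sumr_ge0 => i _; exact: exprn_ge0.
lra.
Qed.

Lemma cmod_sum_le u n :
  cmod (\sum_(0 <= k < n) u k) <= \sum_(0 <= k < n) cmod (u k).
Proof.
elim: n => [|n IH]; first by rewrite !big_geq // ComplexField.Normc.normc0.
by rewrite !big_nat_recr //= (le_trans (le_normcD _ _)) // lerD2r.
Qed.

(** The key step of the identity theorem.  The terms at [z = 1/2] are bounded,
    so [cmod (u k) <= M * 2 ^+ k]; at a small real [z = t] all the terms of
    positive index then add up to at most [4 * M * t], which tends to [0] with
    [t], while the full sum is [0].  The point [z = 0] is left out of the
    hypothesis so that it passes to the series divided by [z]. *)
Lemma power_series_zero_const u :
  (forall z, z != 0 -> `|z| < 1 ->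
     series (fun k => (u k * z ^+ k : C^o)) @ \oo --> (0 : C^o)) ->
  u 0%N = 0.
Proof.
move=> h.
have half0 : (2^-1 : R)%:C != 0 :> C.
  by rewrite -(rmorph0 (real_complex R)) (inj_eq (@complexI R)) invr_eq0.
have half1 : `|(2^-1 : R)%:C| < 1 :> C.
  by rewrite normcC cmod_real -(rmorph1 (real_complex R)) ltcR ger0_norm; lra.
have [M M0 uM] : exists2 M : R, 0 < M & forall k, cmod (u k) <= M * 2 ^+ k.
  have /cvgcP /(_ 1 ltr01) [N _ hN] :
    (fun k => u k * ((2^-1 : R)%:C) ^+ k : C^o) @ \oo --> (0 : C^o).
    by apply: cvg_series_cvg_0; apply/cvg_ex; exists 0; exact: h.
  pose S : R := \sum_(0 <= k < N) cmod (u k).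
  have S0 : 0 <= S by apply: sumr_ge0 => i _; exact: cmod_ge0.
  exists (S + 1) => [|k]; first by lra.
  have p2 : 1 <= 2 ^+ k :> R by apply: exprn_ege1; lra.
  have [kN|Nk] := ltnP k N.
    apply: (@le_trans _ _ (S + 1)); last by rewrite ler_peMr //; lra.
    suff : cmod (u k) <= S by lra.
    rewrite /S (bigD1_seq k) ?mem_index_iota ?iota_uniq //=.
    by rewrite lerDl sumr_ge0 // => i _; exact: cmod_ge0.
  have := hN k Nk.
  rewrite /= sub0r normcN ComplexField.Normc.normcM cmodX cmod_real.
  rewrite ger0_norm; last by lra.
  rewrite exprVn ltr_pdivrMr; last by lra.
  by rewrite mul1r => /ltW /le_trans; apply; rewrite ler_peMl //; lra.
apply: ComplexField.Normc.eq0_normc; apply: contrapT => /eqP nz.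
set A := cmod (u 0%N).
have A0 : 0 < A by rewrite lt_neqAle eq_sym nz cmod_ge0.
(* small enough for both [t <= 1/4] and [4 * M * t < A / 2] *)
pose t : R := A / (8 * M + 4 * A).
have d0 : 0 < 8 * M + 4 * A by lra.
have t0 : 0 < t by rewrite divr_gt0.
have t1 : t * 4 <= 1 by rewrite /t mulrAC ler_pdivrMr //; lra.
have tA : 4 * M * t < A / 2.
  by rewrite /t mulrA ltr_pdivrMr // -subr_gt0; nra.
clearbody t.
have tz : t%:C != 0 :> C.
  by rewrite -(rmorph0 (real_complex R)) (inj_eq (@complexI R)) gt_eqF.
have t11 : `|t%:C| < 1 :> C.
  by rewrite normcC cmod_real -(rmorph1 (real_complex R)) ltcR gtr0_norm //; lra.
have A20 : 0 < A / 2 by lra.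
have /cvgcP /(_ _ A20) [N _ hN] := h _ tz t11.
have := hN N.+1 (leqnSn N).
rewrite /= sub0r normcN /series /= big_nat_recl // expr0 mulr1.
set B := \sum_(0 <= i < N) _ => Bs.
have BA : cmod B <= 4 * M * t.
  apply: (le_trans (cmod_sum_le _ _)).
  apply: (@le_trans _ _ (\sum_(0 <= k < N) 2 * M * t * (2 * t) ^+ k)).
    apply: ler_sum_nat => k _.
    rewrite ComplexField.Normc.normcM cmodX cmod_real gtr0_norm //.
    apply: (@le_trans _ _ (M * 2 ^+ k.+1 * t ^+ k.+1)).
      by rewrite ler_wpM2r // exprn_ge0 // ltW.
    rewrite (exprMn _ 2) !exprS le_eqVlt; apply/orP; left; apply/eqP; ring.
  rewrite -mulr_sumr.
  have -> : 4 * M * t = 2 * M * t * 2 by ring.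
  rewrite ler_wpM2l //; first by rewrite mulr_ge0 ?mulr_ge0 //; lra.
  by apply: geometric_half; lra.
have : A <= cmod (u 0%N + B) + cmod B.
  by rewrite -(normcN B) /A -{1}(addrK B (u 0%N)) le_normcD.
lra.
Qed.

(** A series without constant term can be divided by [z] away from [0], which
    moves each coefficient in turn to index [0]. *)
Lemma power_series_zero u :
  (forall z, z != 0 -> `|z| < 1 ->
     series (fun k => (u k * z ^+ k : C^o)) @ \oo --> (0 : C^o)) ->
  forall k, u k = 0.
Proof.
move=> h k; elim: k u h => [|k IH] u h; first exact: power_series_zero_const.
have u0 := power_series_zero_const _ h.
apply: (IH (fun k => u k.+1)) => z z0 z1.
have /cvg_series_shift := h z z0 z1.
rewrite u0 mul0r subr0 => hs.
rewrite (_ : series _ =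
  fun n => z^-1 * series (fun i => u i.+1 * z ^+ i.+1 : C^o) n).
  by have := cvg_scale z^-1 hs; rewrite mulr0.
apply/funext => n; rewrite /series /= mulr_sumr.
by apply: eq_bigr => i _; rewrite exprS mulrCA mulKf.
Qed.

End ComplexSeries.

(** * Inner product spaces of functions *)

(** An inner product space whose vectors are complex functions, given by a
    membership predicate, an inner product and a norm that are meaningful only
    for members.  It is a predicate on these three data, rather than a structure
    on a type, because square summable functions are a subset of all functions
    on the disk. *)
Record inner_product_space {R : realType} {T : Type} (H : set (T -> R[i]))
    (ip : (T -> R[i]) -> (T -> R[i]) -> R[i]) (N : (T -> R[i]) -> R) : Prop :=
  InnerProductSpace {
    ips_lin : forall f g c, H f -> H g -> H (fun z => c * f z + g z);
    ips_linl : forall f g h c, H f -> H g -> H h ->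
      ip (fun z => c * f z + g z) h = c * ip f h + ip g h;
    ips_conj : forall f g, H f -> H g -> ip g f = (ip f g)^*;
    ips_self : forall f, H f -> ip f f = (N f ^+ 2)%:C;
    ips_norm_ge0 : forall f, 0 <= N f;
    ips_norm_eq0 : forall f, H f -> N f = 0 -> f = fun=> 0 }.

Section InnerProductSpace.
Context {R : realType} {T : Type}.
Local Notation C := R[i].
Local Notation Re := complex.Re.
Context {H : set (T -> C)} {ip : (T -> C) -> (T -> C) -> C}.
Context {N : (T -> C) -> R}.
Implicit Types (f g h u : T -> C) (c : C).
Hypothesis S : inner_product_space H ip N.

Let H_lin {f g} c := ips_lin _ _ _ S f g c.
Let ip_linl {f g h} c := ips_linl _ _ _ S f g h c.
Let ip_conj {f g} := ips_conj _ _ _ S f g.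
Let ip_self {f} := ips_self _ _ _ S f.
Let N_ge0 f := ips_norm_ge0 _ _ _ S f.
Let N_eq0 {f} := ips_norm_eq0 _ _ _ S f.

Lemma subfE f g : f \- g = fun z => -1 * g z + f z.
Proof. by apply/funext => z; rewrite /= mulN1r addrC. Qed.

Lemma space_sub {f g} : H f -> H g -> H (f \- g).
Proof. by move=> Hf Hg; rewrite subfE; apply: H_lin. Qed.

Lemma subff f : f \- f = fun=> 0.
Proof. by apply/funext => z /=; rewrite subrr. Qed.

Lemma space_zero {f} : H f -> H (fun=> 0).
Proof. by move=> Hf; rewrite -(subff f); exact: space_sub. Qed.

Lemma space_scale {f} c : H f -> H (fun z => c * f z).
Proof.
move=> Hf; have := H_lin c Hf (space_zero Hf).
by under eq_fun do rewrite addr0.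
Qed.

Lemma Re_realM (x : R) (z : C) : Re ((x%:C)^* * z) = x * Re z.
Proof. by case: z => a b /=; rewrite oppr0 mul0r subr0. Qed.

Lemma ip_subl {f g h} : H f -> H g -> H h ->
  ip (f \- g) h = ip f h - ip g h.
Proof.
by move=> Hf Hg Hh; rewrite subfE (ip_linl _ Hg Hf Hh) mulN1r addrC.
Qed.

Lemma ip_subr {f g h} : H f -> H g -> H h ->
  ip h (f \- g) = ip h f - ip h g.
Proof.
move=> Hf Hg Hh; have Hfg := space_sub Hf Hg.
rewrite (ip_conj Hfg Hh) (ip_subl Hf Hg Hh) rmorphB /=.
by rewrite (ip_conj Hf Hh) (ip_conj Hg Hh).
Qed.

Lemma ip_linr {f g h} c : H f -> H g -> H h ->
  ip h (fun z => c * f z + g z) = c^* * ip h f + ip h g.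
Proof.
move=> Hf Hg Hh; have Hfg := H_lin c Hf Hg.
rewrite (ip_conj Hfg Hh) (ip_linl c Hf Hg Hh).
rewrite rmorphD rmorphM /=.
by rewrite (ip_conj Hf Hh) (ip_conj Hg Hh).
Qed.

Lemma sub_sqr_real (a b d : R) (z : C) :
  a%:C - z - (z^* - b%:C) = d%:C -> d = a + b - 2 * Re z.
Proof. by case: z => x y /= [<- _]; ring. Qed.

Lemma Re0 : Re (0 : C) = 0.
Proof. by []. Qed.

Lemma Re_conj (x : C) : Re (x^*) = Re x.
Proof. by case: x. Qed.

Lemma norm_sub_sqr {f g} : H f -> H g ->
  N (f \- g) ^+ 2 = N f ^+ 2 + N g ^+ 2 - 2 * Re (ip f g).
Proof.
move=> Hf Hg; have Hfg := space_sub Hf Hg.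
have := ip_self Hfg.
rewrite (ip_subl Hf Hg Hfg) (ip_subr Hf Hg Hf).
rewrite (ip_subr Hf Hg Hg) (ip_self Hf) (ip_self Hg).
by rewrite (ip_conj Hf Hg) => /sub_sqr_real.
Qed.

Lemma norm_pythagoras {f g} : H f -> H g -> ip f g = 0 ->
  N (f \- g) ^+ 2 = N f ^+ 2 + N g ^+ 2.
Proof. by move=> Hf Hg fg0; rewrite (norm_sub_sqr Hf Hg) fg0 Re0 mulr0 subr0. Qed.

Lemma norm_subC {f g} : H f -> H g -> N (f \- g) = N (g \- f).
Proof.
move=> Hf Hg; apply/eqP; rewrite -(@eqrXn2 _ 2) ?N_ge0 //.
rewrite (norm_sub_sqr Hf Hg) (norm_sub_sqr Hg Hf).
rewrite (ip_conj Hf Hg).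
by rewrite Re_conj [X in _ == X - _]addrC.
Qed.

(** A nonnegative real quadratic has nonpositive discriminant; for [Q = 0] it
    is an affine function, which must then be constant. *)
Lemma discriminant_le (P Q r : R) : 0 <= P -> 0 <= Q ->
  (forall t, 0 <= P + t * r + t ^+ 2 * Q) -> r ^+ 2 <= 4 * (P * Q).
Proof.
move=> P0; rewrite le_eqVlt => /orP[/eqP <-|Q0] h.
  have [->|r0] := eqVneq r 0; first by rewrite expr0n /= !mulr0.
  have := h (- (P + 1) / r); rewrite mulfVK // mulr0; lra.
have := h (- r / (2 * Q)).
have -> : P + - r / (2 * Q) * r + (- r / (2 * Q)) ^+ 2 * Q =
    (4 * (P * Q) - r ^+ 2) / (4 * Q) by field; rewrite gt_eqF.
by rewrite ler_pdivlMr ?mul0r ?subr_ge0 // mulr_gt0.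
Qed.

Lemma ip_zeror {f} : H f -> ip f (fun=> 0) = 0.
Proof.
by move=> Hf; rewrite -(subff f) (ip_subr Hf Hf Hf) subrr.
Qed.

Lemma ip_scaler {f g} c : H f -> H g ->
  ip f (fun z => c * g z) = c^* * ip f g.
Proof.
move=> Hf Hg; have := ip_linr c Hg (space_zero Hg) Hf.
under eq_fun do rewrite addr0. rewrite (ip_zeror Hf) addr0. exact.
Qed.

Lemma ip_scalel {f g} c : H f -> H g ->
  ip (fun z => c * f z) g = c * ip f g.
Proof.
move=> Hf Hg; have Hcf := space_scale c Hf.
by rewrite (ip_conj Hg Hcf) (ip_scaler _ Hg Hf) rmorphM /= conjcK
  -(ip_conj Hg Hf).
Qed.

Lemma norm_scale {f} c : H f -> N (fun z => c * f z) = cmod c * N f.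
Proof.
move=> Hf; have Hcf := space_scale c Hf.
apply/eqP; rewrite -(@eqrXn2 _ 2) ?mulr_ge0 ?cmod_ge0 ?N_ge0 //.
apply/eqP/(@complexI R); rewrite -(ip_self Hcf).
rewrite (ip_scaler _ Hcf Hf) (ip_conj Hf Hcf).
rewrite (ip_scaler _ Hf Hf) (ip_self Hf).
rewrite rmorphM /= conjcK oppr0 mulrA [c^* * c]mulrC mulcJ -rmorphM.
by rewrite exprMn.
Qed.

(** Cauchy-Schwarz for the real part: [N (f \- t g) ^+ 2] is a nonnegative
    quadratic in the real number [t]. *)
Lemma Re_ip_sqr_le {f g} : H f -> H g ->
  Re (ip f g) ^+ 2 <= N f ^+ 2 * N g ^+ 2.
Proof.
move=> Hf Hg.
have := @discriminant_le (N f ^+ 2) (N g ^+ 2) (- 2 * Re (ip f g)).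
rewrite !sqr_ge0 => /(_ isT isT) h.
suff : (- 2 * Re (ip f g)) ^+ 2 <= 4 * (N f ^+ 2 * N g ^+ 2).
  by rewrite exprMn sqrrN; lra.
apply: h => t.
have Htg := space_scale t%:C Hg.
have := sqr_ge0 (N (f \- (fun z => t%:C * g z))).
rewrite (norm_sub_sqr Hf Htg) (ip_scaler _ Hf Hg).
rewrite (norm_scale _ Hg) cmod_real exprMn real_normK ?num_real //.
rewrite Re_realM.
by move=> h2; apply: le_trans h2 _; rewrite le_eqVlt; apply/orP; left; apply/eqP; ring.
Qed.

Lemma norm_sub_le {f g} : H f -> H g -> N (f \- g) <= N f + N g.
Proof.
move=> Hf Hg.
rewrite -(@ler_pXn2r _ 2) ?nnegrE ?addr_ge0 ?N_ge0 //.
rewrite (norm_sub_sqr Hf Hg) sqrrD.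
suff : - (N f * N g) <= Re (ip f g) by lra.
have := Re_ip_sqr_le Hf Hg; rewrite -exprMn.
rewrite -ler_sqrt ?sqr_ge0 // !sqrtr_sqr [`|N f * _|]ger0_norm ?mulr_ge0 ?N_ge0 //.
by rewrite ler_norml => /andP[].
Qed.

Lemma norm_triangle {f g h} : H f -> H g -> H h ->
  N (f \- g) <= N (h \- f) + N (h \- g).
Proof.
move=> Hf Hg Hh; rewrite addrC.
have := norm_sub_le (space_sub Hh Hg) (space_sub Hh Hf).
rewrite (_ : (h \- g) \- (h \- f) = f \- g) //.
by apply/funext => z /=; ring.
Qed.

Lemma norm_subff {f} : H f -> N (f \- f) = 0.
Proof.
move=> Hf; have Hff := space_sub Hf Hf; have := ip_self Hff.
rewrite (ip_subl Hf Hf Hff) subrr => /(@complexI R)/esym/eqP.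
by rewrite sqrf_eq0 => /eqP.
Qed.

Lemma norm_sub_eq0 {f g} : H f -> H g -> N (f \- g) = 0 -> f = g.
Proof.
move=> Hf Hg /(N_eq0 (space_sub Hf Hg)) fg; apply/funext => z.
by apply/eqP; rewrite -subr_eq0; apply/eqP; exact: (congr1 (@^~ z) fg).
Qed.

(** Pythagoras for [g \- u = (g \- h) \- (u \- h)]. *)
Lemma norm_projection {u h g} : H u -> H h -> H g ->
  ip (u \- h) h = 0 -> ip (u \- h) g = 0 ->
  N (g \- u) ^+ 2 = N (g \- h) ^+ 2 + N (u \- h) ^+ 2.
Proof.
move=> Hu Hh Hg hh hg; have Huh := space_sub Hu Hh; have Hgh := space_sub Hg Hh.
rewrite -norm_pythagoras // ?(ip_conj Huh Hgh) ?(ip_subr Hg Hh Huh) ?hg ?hh.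
  by congr (N _ ^+ 2); apply/funext => z /=; ring.
by rewrite subrr conjc0.
Qed.

(** Distances to [u] and to [h] are ordered in the same way on vectors
    orthogonal to [u \- h]. *)
Lemma norm_projection_mono {u h g k} : H u -> H h -> H g -> H k ->
  ip (u \- h) h = 0 -> ip (u \- h) g = 0 -> ip (u \- h) k = 0 ->
  N (g \- u) <= N (k \- u) -> N (g \- h) <= N (k \- h).
Proof.
move=> Hu Hh Hg Hk hh hg hk.
rewrite -(@ler_pXn2r _ 2 isT (N (g \- u))) ?nnegrE ?N_ge0 //.
rewrite -(@ler_pXn2r _ 2 isT (N (g \- h))) ?nnegrE ?N_ge0 //.
by rewrite (norm_projection Hu Hh Hg hh hg) (norm_projection Hu Hh Hk hh hk) lerD2r.
Qed.

Lemma norm_projection_min {u h g} : H u -> H h -> H g ->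
  ip (u \- h) h = 0 -> ip (u \- h) g = 0 -> N (u \- h) <= N (u \- g).
Proof.
move=> Hu Hh Hg hh hg; have P := norm_projection Hu Hh Hg hh hg.
rewrite -(@ler_pXn2r _ 2 isT (N (u \- h))) ?nnegrE ?N_ge0 //.
by rewrite (norm_subC Hu Hg) P lerDr sqr_ge0.
Qed.

End InnerProductSpace.

(** * Power series coefficients *)

Section Coefficients.
Context {R : realType}.
Local Notation C := R[i].
Implicit Types (f g u v : disk R -> C) (a b : nat -> C) (c : C).

(** The difference of the two series vanishes identically on the disk. *)
Lemma power_series_unique {f a b} :
  power_series_of f a -> power_series_of f b -> a = b.
Proof.
move=> fa fb; apply/funext => k; apply/eqP; rewrite -subr_eq0; apply/eqP.
apply: (power_series_zero (fun k => a k - b k)) => z z0 z1.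
have := cvg_series_lin (-1) (fb (exist _ z z1)) (fa (exist _ z z1)).
rewrite mulN1r addNr /=.
under eq_fun do rewrite mulN1r addrC -mulrBl.
exact.
Qed.

Lemma coefsE {f a} : power_series_of f a -> coefs f = a.
Proof.
move=> fa; rewrite /coefs; case: xgetP => [_ -> fb|/(_ a)//].
exact: power_series_unique fb fa.
Qed.

Lemma power_series_inj {f g a} :
  power_series_of f a -> power_series_of g a -> f = g.
Proof.
move=> fa ga; apply/funext => z.
exact: (@cvg_unique C^o _ _ _ _ _ (fa z) (ga z)).
Qed.

Lemma power_series_lin {f g a b} c :
  power_series_of f a -> power_series_of g b ->
  power_series_of (fun z => c * f z + g z) (fun k => c * a k + b k).
Proof.
move=> fa gb z; have := cvg_series_lin c (fa z) (gb z).
by under eq_fun do rewrite mulrA -mulrDl.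
Qed.

Lemma power_series_shift {f a} : power_series_of f a ->
  power_series_of (fun z => val z * f z) (shift a).
Proof.
move=> fa z.
set s := fun k => _.
have := @cvg_series_unshift _ C^o s (val z * f z).
rewrite {3}/s /= mul0r addr0; apply.
rewrite (_ : series _ =
  fun n => val z * series (fun k => a k * val z ^+ k : C^o) n).
  exact: cvg_scale (fa z).
apply/funext => n; rewrite /series /= mulr_sumr.
by apply: eq_bigr => i _; rewrite /s /= exprS mulrCA.
Qed.

Lemma power_series_zero_fun : power_series_of (fun=> 0) (fun=> 0 : C).
Proof.
move=> z; rewrite (_ : series _ = fun=> 0); first exact: cvg_cst.
by apply/funext => n; rewrite /series /= big1 // => i _; rewrite mul0r.
Qed.

Lemma coefs_zero_fun : coefs (fun=> 0) = fun=> (0 : C).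
Proof. exact: coefsE power_series_zero_fun. Qed.

Lemma power_series_hone : power_series_of hone (fun k => (k == 0%N)%:R : C).
Proof.
move=> z; set s := fun k => _.
have -> : hone z = 0 + s 0%N by rewrite add0r /s /= mul1r expr0.
apply: (@cvg_series_unshift _ C^o s 0).
rewrite (_ : series _ = fun=> 0); first exact: cvg_cst.
by apply/funext => n; rewrite /series /= big1 // => i _; rewrite /s mul0r.
Qed.

Lemma power_series_at0 {f a} : power_series_of f a -> f (disk0 R) = a 0%N.
Proof.
move=> fa; apply: (@cvg_unique C^o _ _ _ _ _ (fa (disk0 R))) => //=.
pose s k : C^o := a k * 0 ^+ k.
have -> : a 0%N = 0 + s 0%N by rewrite add0r /s /= expr0 mulr1.
apply: (@cvg_series_unshift _ C^o s 0).
rewrite (_ : series _ = fun=> 0); first exact: cvg_cst.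
apply/funext => n; rewrite /series /= big1 // => i _.
by rewrite /s /= exprS mul0r mulr0.
Qed.

End Coefficients.

(** * The space H2 as an inner product space *)

Section WeightedSpace.
Context {R : realType} (w : nat -> R).
Hypothesis w_gt0 : forall k, 0 < w k.
Hypothesis w0 : w 0%N = 1.
Hypothesis w_ratio : (fun k => w k / w k.+1) @ \oo --> (1 : R).
Local Notation C := R[i].
Local Notation Re := complex.Re.
Local Notation Im := complex.Im.
Implicit Types (f g u v h : disk R -> C) (c : C) (p q : {poly C}).
Local Notation H2 := (H2 w).
Local Notation N := (hnorm w).
Local Notation ip := (hinner w).

Let w_ge0 k : 0 <= w k. Proof. exact: ltW. Qed.

Let term_ge0 (z : C) k : 0 <= cmod z ^+ 2 * w k.
Proof. by rewrite mulr_ge0 ?sqr_ge0. Qed.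

Lemma H2_coefs {f} : H2 f -> power_series_of f (coefs f).
Proof. by case. Qed.

Lemma coefs_lin {f g} c : H2 f -> H2 g ->
  coefs (fun z => c * f z + g z) = fun k => c * coefs f k + coefs g k.
Proof. by move=> [fa _] [ga _]; apply/coefsE/power_series_lin. Qed.

Lemma is_cvg_series_lin (s t : nat -> R) (x y : R) :
  cvgn (series s) -> cvgn (series t) ->
  cvgn (series (fun k => x * s k + y * t k)).
Proof.
move=> hs ht.
exact: (@is_cvg_seriesD _ (x *: s) (y *: t) (is_cvg_seriesZ hs)
  (is_cvg_seriesZ ht)).
Qed.

Lemma coefs_eq0 f : H2 f -> (forall k, coefs f k = 0) -> f = fun=> 0.
Proof.
move=> Hf c0; apply: power_series_inj (H2_coefs Hf) _.
by have -> : coefs f = fun=> 0; [exact/funext | exact: power_series_zero_fun].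
Qed.

(** The termwise bound from which square summability of a linear combination
    follows by comparison. *)
Lemma cmod_sqr_lin_le (c x y : C) (r : R) : 0 <= r ->
  cmod (c * x + y) ^+ 2 * r <=
    2 * cmod c ^+ 2 * (cmod x ^+ 2 * r) + 2 * (cmod y ^+ 2 * r).
Proof.
move=> r0.
have -> : 2 * cmod c ^+ 2 * (cmod x ^+ 2 * r) + 2 * (cmod y ^+ 2 * r) =
    (2 * cmod (c * x) ^+ 2 + 2 * cmod y ^+ 2) * r.
  by rewrite ComplexField.Normc.normcM; ring.
apply: ler_wpM2r => //; rewrite !cmod_sqr raddfD [Im (_ + _)]raddfD /=.
move: (Re (c * x)) (Im (c * x)) (Re y) (Im y) => x1 x2 y1 y2.
have := sqr_ge0 (x1 - y1); have := sqr_ge0 (x2 - y2).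
nra.
Qed.

Lemma H2_lin {f g} c : H2 f -> H2 g -> H2 (fun z => c * f z + g z).
Proof.
move=> Hf Hg; have E := coefs_lin c Hf Hg.
split; rewrite E; first exact: power_series_lin (H2_coefs Hf) (H2_coefs Hg).
apply: (@series_le_cvg _ _ (fun k => 2 * cmod c ^+ 2 *
  (cmod (coefs f k) ^+ 2 * w k) + 2 * (cmod (coefs g k) ^+ 2 * w k)))
  => [k|k|k|].
- exact: term_ge0.
- by rewrite addr_ge0 // mulr_ge0 ?term_ge0 // mulr_ge0 // sqr_ge0.
- exact: cmod_sqr_lin_le.
- exact: is_cvg_series_lin Hf.2 Hg.2.
Qed.

Lemma H2_hone : H2 hone.
Proof.
split; rewrite (coefsE power_series_hone); first exact: power_series_hone.
apply/cvg_ex; eexists; apply: cvg_series_unshift.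
rewrite (_ : series _ = fun=> 0); first exact: cvg_cst.
apply/funext => n; rewrite /series /= big1 // => i _.
by rewrite expr0n /= addr0 sqrtr0 expr0n mul0r.
Qed.

Lemma H2_zero : H2 (fun=> 0).
Proof.
have := H2_lin (-1) H2_hone H2_hone.
by under eq_fun do rewrite mulN1r addNr.
Qed.

(** Eventually [w k / w k.+1 > 1/2]; the finitely many other quotients
    [w k.+1 / w k] are bounded by their sum. *)
Lemma weight_succ_bound : exists2 K : R, 0 <= K & forall k, w k.+1 <= K * w k.
Proof.
have /cvgrPdist_lt /(_ 2^-1) := w_ratio.
have h2 : (0 : R) < 2^-1 by lra.
move=> /(_ h2) [n _ hn].
pose S : R := \sum_(0 <= k < n) w k.+1 / w k.
have r0 k : 0 <= w k.+1 / w k by rewrite divr_ge0.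
have S0 : 0 <= S by apply: sumr_ge0 => i _; exact: r0.
exists (S + 2) => [|k]; first by lra.
rewrite -ler_pdivrMr //.
have [kn|nk] := ltnP k n.
  suff : w k.+1 / w k <= S by lra.
  rewrite /S (bigD1_seq k) ?mem_index_iota ?iota_uniq //=.
  by rewrite lerDl sumr_ge0.
have := hn k nk; rewrite /= ltr_distlC => /andP[+ _] => h.
suff : w k.+1 / w k <= 2 by lra.
rewrite ler_pdivrMr //.
have : 2^-1 * w k.+1 <= w k.
  by rewrite -ler_pdivlMr //; lra.
lra.
Qed.

(** The coefficients are shifted by one place, so the weights change from
    [w k] to [w k.+1], which costs a bounded factor. *)
Lemma H2_mulX {f} : H2 f -> H2 (fun z => val z * f z).
Proof.
move=> Hf; have ps := power_series_shift (H2_coefs Hf).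
split; rewrite (coefsE ps) //.
have [K K0 wK] := weight_succ_bound.
suff S : cvgn (series (fun k => cmod (coefs f k) ^+ 2 * w k.+1)).
  exact: cvgP (cvg_series_unshift
    (fun k => cmod (shift (coefs f) k) ^+ 2 * w k) _ S).
apply: (@series_le_cvg _ _ (K *: (fun k => cmod (coefs f k) ^+ 2 * w k))) => [k|k|k|].
- by rewrite mulr_ge0 ?sqr_ge0.
- by rewrite mulr_ge0 // mulr_ge0 ?sqr_ge0.
- by rewrite fctE /GRing.scale /= mulrCA ler_wpM2l ?sqr_ge0.
- by apply: is_cvg_seriesZ; exact: Hf.2.
Qed.

Lemma pmul_MXaddC p c f :
  pmul (p * 'X + c%:P) f = fun z => c * f z + val z * pmul p f z.
Proof.
apply/funext => z; rewrite /pmul hornerMXaddC mulrDl addrC.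
by congr (_ + _); rewrite mulrAC mulrC.
Qed.

Lemma pmul0 f : pmul 0 f = fun=> 0.
Proof. by apply/funext => z; rewrite /pmul horner0 mul0r. Qed.

Lemma H2_pmul p {f} : H2 f -> H2 (pmul p f).
Proof.
move=> Hf; elim/poly_ind: p => [|p c IH].
  rewrite pmul0; exact: H2_zero.
rewrite pmul_MXaddC; apply: H2_lin; first exact: Hf.
exact: H2_mulX.
Qed.

Lemma Re_mulJ_le (x y : C) : `|Re (x * y^*)| <= cmod x ^+ 2 + cmod y ^+ 2.
Proof.
case: x y => [x1 x2] [y1 y2]; rewrite !cmod_sqr /= ler_norml.
have := sqr_ge0 (x1 - y1); have := sqr_ge0 (x2 - y2).
have := sqr_ge0 (x1 + y1); have := sqr_ge0 (x2 + y2).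
by move=> *; apply/andP; split; nra.
Qed.

Lemma Im_mulJ_le (x y : C) : `|Im (x * y^*)| <= cmod x ^+ 2 + cmod y ^+ 2.
Proof.
case: x y => [x1 x2] [y1 y2]; rewrite !cmod_sqr /= ler_norml.
have := sqr_ge0 (x1 - y2); have := sqr_ge0 (x2 - y1).
have := sqr_ge0 (x1 + y2); have := sqr_ge0 (x2 + y1).
by move=> *; apply/andP; split; nra.
Qed.

Lemma is_cvg_series_dominated (s t1 t2 : nat -> R) :
  (forall k, `|s k| <= t1 k + t2 k) ->
  cvgn (series t1) -> cvgn (series t2) -> cvgn (series s).
Proof.
move=> st h1 h2; apply: normed_cvg.
apply: (@series_le_cvg _ _ (fun k => t1 k + t2 k)) => [k|k|k|].
- exact: normr_ge0.
- exact: le_trans (normr_ge0 _) (st k).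
- exact: st.
- exact: is_cvg_seriesD.
Qed.

Lemma sum_complex (u : nat -> C) n :
  \sum_(0 <= k < n) u k =
  (\sum_(0 <= k < n) Re (u k)) +i* (\sum_(0 <= k < n) Im (u k)).
Proof.
elim: n => [|n IH]; first by rewrite !big_geq.
by rewrite !big_nat_recr //= IH; case: (u n).
Qed.

Lemma ReMr (x : C) (r : R) : Re (x * r%:C) = Re x * r.
Proof. by case: x => a b /=; rewrite mulr0 subr0. Qed.

Lemma ImMr (x : C) (r : R) : Im (x * r%:C) = Im x * r.
Proof. by case: x => a b /=; rewrite mulr0 add0r. Qed.

(** Real and imaginary parts of the terms are dominated by the sum of the
    terms of the two square norms, hence both series converge absolutely. *)
Lemma hinner_cvg {f g} : H2 f -> H2 g ->
  series (fun k => (coefs f k * (coefs g k)^* * (w k)%:C : C^o))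
    @ \oo --> (ip f g : C^o).
Proof.
move=> [_ Hf] [_ Hg].
pose s k : C^o := coefs f k * (coefs g k)^* * (w k)%:C.
suff : cvgn (series s) by exact.
have hr : cvgn (series (fun k => Re (s k))).
  apply: is_cvg_series_dominated Hf Hg => k; rewrite /s ReMr normrM.
  by rewrite (gtr0_norm (w_gt0 k)) -mulrDl ler_wpM2r // Re_mulJ_le.
have hi : cvgn (series (fun k => Im (s k))).
  apply: is_cvg_series_dominated Hf Hg => k; rewrite /s ImMr normrM.
  by rewrite (gtr0_norm (w_gt0 k)) -mulrDl ler_wpM2r // Im_mulJ_le.
have := cvg_complex hr hi.
under eq_fun do rewrite -sum_complex.
exact: cvgP.
Qed.

Lemma hinner_unique {f g} (l : C) :
  H2 f -> H2 g ->
  series (fun k => (coefs f k * (coefs g k)^* * (w k)%:C : C^o))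
    @ \oo --> (l : C^o) -> ip f g = l.
Proof.
move=> Hf Hg hl.
set s := series _ in hl.
have E := @cvg_lim C^o (@norm_hausdorff _ C^o) _ \oo _ _ _ hl.
by rewrite /hinner -[RHS]E.
Qed.

Lemma hinner_linl f g h c : H2 f -> H2 g -> H2 h ->
  ip (fun z => c * f z + g z) h = c * ip f h + ip g h.
Proof.
move=> Hf Hg Hh; apply: (hinner_unique _ (H2_lin c Hf Hg) Hh).
have := cvg_series_lin c (hinner_cvg Hf Hh) (hinner_cvg Hg Hh).
rewrite (coefs_lin c Hf Hg).
by under eq_fun do rewrite !mulrA -!mulrDl.
Qed.

Lemma hinner_conj f g : H2 f -> H2 g -> ip g f = (ip f g)^*.
Proof.
move=> Hf Hg; apply: (hinner_unique _ Hg Hf).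
have := cvg_conj (hinner_cvg Hf Hg).
set s := (X in X @ _ --> _ -> _).
rewrite (_ : series _ = s) //; apply/funext => n.
rewrite /s /series /= rmorph_sum; apply: eq_bigr => k _.
by rewrite !rmorphM /= conjcK oppr0 [(coefs f k)^* * _]mulrC.
Qed.

Lemma hnorm_sqr_cvg {f} : H2 f ->
  series (fun k => cmod (coefs f k) ^+ 2 * w k) @ \oo --> N f ^+ 2.
Proof.
move=> [_ Hf]; rewrite /hnorm sqr_sqrtr //.
by apply: limr_ge => //; apply: nearW => n; exact: sumr_ge0.
Qed.

Lemma hinner_self f : H2 f -> ip f f = (N f ^+ 2)%:C.
Proof.
move=> Hf; apply: (hinner_unique _ Hf Hf).
have := cvg_real (hnorm_sqr_cvg Hf).
set s := (X in X @ _ --> _ -> _).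
rewrite (_ : series _ = s) //; apply/funext => n.
rewrite /s /series /= rmorph_sum; apply: eq_bigr => k _.
by rewrite mulcJ -rmorphM.
Qed.

Lemma hnorm_ge0 f : 0 <= N f.
Proof. exact: sqrtr_ge0. Qed.

(** All terms of a nonnegative series with sum [0] vanish. *)
Lemma hnorm_eq0 f : H2 f -> N f = 0 -> f = fun=> 0.
Proof.
move=> Hf Nf0.
have hl := hnorm_sqr_cvg Hf.
have c0 k : coefs f k = 0.
  apply: ComplexField.Normc.eq0_normc.
  apply/eqP; rewrite -sqrf_eq0 -(mulIr_eq0 _ (mulIf (lt0r_neq0 (w_gt0 k)))).
  rewrite eq_le term_ge0 andbT.
  have nd : {homo series (fun k => cmod (coefs f k) ^+ 2 * w k) :
      n m / (n <= m)%N >-> n <= m}.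
    by apply/nondecreasing_seqP => n; rewrite /series /= big_nat_recr //= lerDl.
  have := nondecreasing_cvgn_le nd (cvgP _ hl) k.+1.
  rewrite (cvg_lim _ hl) // Nf0 expr0n /=; apply: le_trans.
  by rewrite /series /= big_nat_recr //= lerDr sumr_ge0.
exact: coefs_eq0 Hf c0.
Qed.

(** Evaluation at [0] is represented by the constant [1], as [w 0 = 1]. *)
Lemma hinner_one f : H2 f -> ip hone f = (f (disk0 R))^*.
Proof.
move=> Hf; apply: (hinner_unique _ H2_hone Hf).
rewrite (coefsE power_series_hone).
pose s k : C^o := (k == 0%N)%:R * (coefs f k)^* * (w k)%:C.
have -> : (f (disk0 R))^* = 0 + s 0%N.
  by rewrite add0r /s /= w0 mul1r mulr1 (power_series_at0 (H2_coefs Hf)).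
apply: (@cvg_series_unshift _ C^o s 0).
rewrite (_ : series _ = fun=> 0); first exact: cvg_cst.
by apply/funext => n; rewrite /series /= big1 // => i _; rewrite /s !mul0r.
Qed.

Lemma H2_inner_product : inner_product_space H2 ip N.
Proof.
split.
- by move=> f g c; exact: H2_lin.
- exact: hinner_linl.
- exact: hinner_conj.
- exact: hinner_self.
- exact: hnorm_ge0.
- exact: hnorm_eq0.
Qed.

(** * Products with polynomials and inner functions *)

Lemma pmulC c f : pmul c%:P f = fun z => c * f z.
Proof. by apply/funext => z; rewrite /pmul hornerC. Qed.

Lemma pmulB p q f : pmul (p - q) f = pmul p f \- pmul q f.
Proof. by apply/funext => z; rewrite /pmul hornerD hornerN mulrBl. Qed.

Lemma pmul_addZXn p c n f :
  pmul (p + c *: 'X^n) f = fun z => c * pmul 'X^n f z + pmul p f z.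
Proof.
by apply/funext => z; rewrite /pmul hornerD hornerZ mulrDl addrC mulrA.
Qed.

Lemma coefs_pmul_MXaddC p c {f} : H2 f -> coefs (pmul (p * 'X + c%:P) f) =
  fun k => c * coefs f k + shift (coefs (pmul p f)) k.
Proof.
move=> Hf; rewrite pmul_MXaddC; apply: coefsE.
exact: power_series_lin c (H2_coefs Hf)
  (power_series_shift (H2_coefs (H2_pmul p Hf))).
Qed.

(** Multiplication by a polynomial cannot lower the order of vanishing
    at [0]. *)
Lemma coefs_pmul_low p {f m} : H2 f ->
  (forall k, (k < m)%N -> coefs f k = 0) ->
  forall k, (k < m)%N -> coefs (pmul p f) k = 0.
Proof.
move=> Hf low; elim/poly_ind: p => [|p c IH] k km.
  by rewrite pmul0 coefs_zero_fun.
rewrite (coefs_pmul_MXaddC _ _ Hf) low // mulr0 add0r.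
by case: k km => [|k] //= /ltnW; exact: IH.
Qed.

(** If [f] vanishes to the order [m] at [0], the coefficient of index [m] of
    [pmul p f] is the constant term of [p] times a nonzero number; so that
    constant term is [0], and [p] can be divided by ['X]. *)
Lemma pmul_eq0 p f : H2 f -> (exists z, f z != 0) ->
  pmul p f = (fun=> 0) -> p = 0.
Proof.
move=> Hf [z0 fz0].
have [m fm low] : exists2 m, coefs f m != 0 &
    forall k, (k < m)%N -> coefs f k = 0.
  have ex : exists m, coefs f m != 0.
    apply: contrapT => nex; move/negP: fz0; apply; apply/eqP.
    rewrite (coefs_eq0 f Hf) // => k.
    by apply/eqP/negPn/negP => fk; apply: nex; exists k.
  case: (ex_minnP ex) => m fm mmin; exists m => // k km.
  by apply/eqP/negPn/negP => /mmin; rewrite leqNgt km.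
elim/poly_ind: p => // p c IH pf0.
have Hpf := H2_pmul p Hf.
have E k : c * coefs f k + shift (coefs (pmul p f)) k = 0.
  by rewrite -(congr1 (@^~ k) (coefs_pmul_MXaddC p c Hf)) pf0 coefs_zero_fun.
have c0 : c = 0.
  have := E m; rewrite (_ : shift _ m = 0); last first.
    by case: (m) low => [|m'] low //=; exact: coefs_pmul_low low _ _.
  by rewrite addr0 => /eqP; rewrite mulf_eq0 (negPf fm) orbF => /eqP.
rewrite c0 addr0 IH ?mul0r //.
by apply: coefs_eq0 => // k; have := E k.+1; rewrite c0 mul0r add0r.
Qed.

(** Since [f] is orthogonal to all its proper shifts and has norm [1], only
    the constant term of the polynomial contributes. *)
Lemma inner_hinner_poly f : H_inner w f -> forall n (a : nat -> C),
  ip f (pmul (\sum_(i < n) a i *: 'X^i) f) = (if (0 < n)%N then a 0%N else 0)^*.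
Proof.
move=> [Hf Nf1 orth] n a; pose S := H2_inner_product.
elim: n => [|n IH].
  by rewrite big_ord0 pmul0 (ip_zeror S Hf) conjc0.
rewrite big_ord_recr /= pmul_addZXn.
rewrite (ip_linr S (a n) (H2_pmul _ Hf) (H2_pmul _ Hf) Hf) IH.
case: n IH => [|n] _.
  have -> : pmul 'X^0 f = f.
    by apply/funext => z; rewrite /pmul expr0 hornerC mul1r.
  by rewrite [(0 < 0)%N]ltnn conjc0 addr0 (hinner_self _ Hf) Nf1 expr1n mulr1.
have -> : ip f (pmul ('X^(n.+1)) f) = (ip (pmul ('X^(n.+1)) f) f)^*.
  exact: (hinner_conj _ _ (H2_pmul _ Hf) Hf).
by rewrite orth // conjc0 mulr0 add0r.
Qed.

(** The multiple [conj (f 0) f] is the projection of [1] onto the span of the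
    polynomial multiples of [f]: against [pmul q f], both [1] and this multiple
    give the conjugate of [f 0 * q`_0]. *)
Lemma inner_residual_orthogonal f : H_inner w f -> forall q,
  ip (hone \- pmul ((f (disk0 R))^*)%:P f) (pmul q f) = 0.
Proof.
move=> inn q; have [Hf _ _] := inn; pose S := H2_inner_product.
have Hq := H2_pmul q Hf.
rewrite (ip_subl S H2_hone (H2_pmul _ Hf) Hq) (hinner_one _ Hq) pmulC.
rewrite (ip_scalel S _ Hf Hq).
have -> : ip f (pmul q f) = (q`_0)^*.
  rewrite -{1}(coefK q) poly_def (inner_hinner_poly _ inn).
  by case: (posnP (size q)) => [/eqP|//]; rewrite size_poly_eq0 => /eqP ->;
    rewrite coef0.
rewrite /pmul /= horner_coef0 rmorphM /= mulrC.
by rewrite subrr.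
Qed.

Lemma inner_residual_norm f : H_inner w f ->
  N (hone \- pmul ((f (disk0 R))^*)%:P f) ^+ 2 = 1 - cmod (f (disk0 R)) ^+ 2.
Proof.
move=> inn; have [Hf Nf1 _] := inn; pose S := H2_inner_product.
have N1 : N hone ^+ 2 = 1.
  apply: (@complexI R); rewrite -(hinner_self _ H2_hone) (hinner_one _ H2_hone).
  exact: conjc1.
rewrite (norm_sub_sqr S H2_hone (H2_pmul _ Hf)) (hinner_one _ (H2_pmul _ Hf)).
rewrite pmulC (norm_scale S _ Hf) Nf1 N1 mulr1 cmod_conj Re_conj.
rewrite [_ * f _]mulrC mulcJ /=.
ring.
Qed.

Lemma pmul_cyclic_span q f : H2 f -> cyclic_span w f (pmul q f).
Proof.
move=> Hf; split=> [|e e0]; first exact: H2_pmul.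
by exists q; rewrite (norm_subff H2_inner_product (H2_pmul q Hf)).
Qed.

(** Elements of the cyclic span are only limits of polynomial multiples, so
    the lower bound is obtained up to [e] from the triangle inequality. *)
Lemma hdist_inner f : H_inner w f ->
  hdist w hone (cyclic_span w f) = N (hone \- pmul ((f (disk0 R))^*)%:P f).
Proof.
move=> inn; have [Hf _ _] := inn; pose S := H2_inner_product.
set h := pmul _ f; have Hh : H2 h := H2_pmul _ Hf.
have hspan : cyclic_span w f h by exact: pmul_cyclic_span.
have lb : lbound [set N (hone \- g) | g in cyclic_span w f] (N (hone \- h)).
  move=> _ [g [Hg gapp] <-]; apply/ler_addgt0Pr => e e0.
  have [q qe] := gapp e e0; have Hq := H2_pmul q Hf.
  apply: (@le_trans _ _ (N (hone \- pmul q f))).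
    exact: (norm_projection_min S H2_hone Hh Hq
      (inner_residual_orthogonal _ inn _) (inner_residual_orthogonal _ inn q)).
  have T := norm_triangle S H2_hone Hq Hg.
  apply: (le_trans T); rewrite (norm_subC S Hg H2_hone) lerD2l.
  by rewrite (norm_subC S Hg Hq); exact: ltW qe.
apply/eqP; rewrite eq_le; apply/andP; split.
  by apply: ge_inf; [exists (N (hone \- h)) | exists h].
by apply: lb_le_inf => //; exists (N (hone \- h)), h.
Qed.

End WeightedSpace.

(** * Optimal approximants *)

Theorem theorem2p3 (R : realType) (w : nat -> R)
  (w_gt0 : forall k, 0 < w k) (w0 : w 0%N = 1)
  (w_ratio : (fun k => w k / w k.+1) @ \oo --> (1 : R))
  (f : disk R -> R[i]) (Hf : H2 w f) (f_neq0 : exists z, f z != 0)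
  (p : nat -> {poly R[i]})
  (p_opt : forall n, is_optimal_approximant w f n (p n)) :
  (* (a) *)
  (forall h : disk R -> R[i],
     is_orthogonal_projection w (cyclic_span w f) hone h ->
     (fun n => hnorm w (pmul (p n) f \- h)) @ \oo --> (0 : R) /\
     (forall g, H2 w g ->
        (fun n => hnorm w (pmul (p n) f \- g)) @ \oo --> (0 : R) -> g = h)) /\
  (* (b) *)
  (H_inner w f -> forall n, p n = ((f (disk0 R))^*)%:P) /\
  (* (c) *)
  (H_inner w f -> forall n,
     hnorm w (pmul (p n) f \- hone) ^+ 2 = hdist w hone (cyclic_span w f) ^+ 2 /\
     hdist w hone (cyclic_span w f) ^+ 2 = 1 - cmod (f (disk0 R)) ^+ 2).
Proof.
pose S := H2_inner_product w w_gt0.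
have H1 : H2 w hone := H2_hone w.
have Hq q : H2 w (pmul q f) := H2_pmul w w_gt0 w_ratio q Hf.
have qspan q := pmul_cyclic_span w w_gt0 w_ratio q f Hf.
have b : H_inner w f -> forall n, p n = ((f (disk0 R))^*)%:P.
  move=> inn n; have [_ popt] := p_opt n.
  have orth := inner_residual_orthogonal w w_gt0 w0 w_ratio f inn.
  set c := _%:P.
  have sc : (size c <= n.+1)%N by rewrite (leq_trans (size_polyC_leq1 _)).
  have M := norm_projection_mono S H1 (Hq c) (Hq (p n)) (Hq c) (orth c)
    (orth (p n)) (orth c) (popt c sc).
  rewrite (norm_subff S (Hq c)) in M.
  have E : pmul (p n) f = pmul c f.
    apply: (norm_sub_eq0 S (Hq _) (Hq _)).
    by apply/eqP; rewrite eq_le M (ips_norm_ge0 _ _ _ S).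
  apply/eqP; rewrite -subr_eq0; apply/eqP.
  apply: (pmul_eq0 w w_gt0 w_ratio _ f Hf f_neq0).
  by rewrite pmulB E subff.
split; last split => //.
- move=> h [[Hh happ] orth].
  have oh := orth h (conj Hh happ).
  have oq q := orth _ (qspan q).
  have cv : (fun n => hnorm w (pmul (p n) f \- h)) @ \oo --> (0 : R).
    apply/cvgrPdist_lt => e e0; have [q qe] := happ e e0.
    near=> n.
    rewrite sub0r normrN (ger0_norm (ips_norm_ge0 _ _ _ S _)).
    apply: le_lt_trans qe.
    apply: (norm_projection_mono S H1 Hh (Hq (p n)) (Hq q) oh (oq (p n)) (oq q)).
    apply: (p_opt n).2.
    by apply: leqW; near: n; exact: nbhs_infty_ge.
  split=> // g Hg cg.
  apply: (norm_sub_eq0 S Hg Hh); apply/eqP; rewrite eq_le.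
  rewrite (ips_norm_ge0 _ _ _ S) andbT.
  have cs : (fun n => hnorm w (pmul (p n) f \- g) +
      hnorm w (pmul (p n) f \- h)) @ \oo --> (0 : R).
    by rewrite -[0]addr0; exact: cvgD cg cv.
  rewrite -(cvg_lim (@Rhausdorff R) cs); apply: limr_ge.
    exact: (cvgP _ cs).
  by apply: nearW => n; exact: (norm_triangle S Hg Hh (Hq (p n))).
- move=> inn n; rewrite (b inn n).
  rewrite (hdist_inner w w_gt0 w0 w_ratio f inn) (norm_subC S (Hq _) H1).
  by split=> //; exact: (inner_residual_norm w w_gt0 w0 w_ratio f inn).
Unshelve. all: by end_near.
Qed.
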